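(* Let $\mathcal D$ be the mirror Heisenberg–Virasoro algebra, with basis $\{d_m,h_r,\mathbf c,\mathbf l: m\in\mathbb Z, r\in\frac12+\mathbb Z\}$ and brackets $[d_m,d_n]=(m-n)d_{m+n}+\frac{m^3-m}{12}\delta_{m+n,0}\mathbf c$, $[d_m,h_r]=-rh_{m+r}$, $[h_r,h_s]=r\delta_{r+s,0}\mathbf l$, $[\mathbf c,\mathcal D]=[\mathbf l,\mathcal D]=0$. Let $\mathcal H=\mathrm{Span}\{h_r,\mathbf l: r\in\frac12+\mathbb Z\}$ and $\mathfrak p=\mathbb C\mathbf c\oplus\mathcal H$. Let $\phi:\mathfrak p\to\mathbb C$ be a Lie algebra homomorphism with $\phi(\mathcal H)\neq 0$. Then $W(\phi)$ is irreducible if and only if $\phi$ is not an exp-polynomial function.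
   Context: A Lie algebra homomorphism $\phi:\mathfrak p\to\mathbb C$ is a linear map vanishing on $[\mathfrak p,\mathfrak p]=\mathbb C\mathbf l$. $W(\phi)=\mathcal U(\mathcal D)\otimes_{\mathcal U(\mathfrak p)}\mathbb C w_\phi$, where $\mathbb C w_\phi$ is the one-dimensional $\mathfrak p$-module with $pw_\phi=\phi(p)w_\phi$. $\phi$ is called an exp-polynomial function if there exist distinct nonzero complex numbers $a_1,\dots,a_\ell$ and polynomials $f_1,\dots,f_\ell\in\mathbb C[t]$ such that $\phi(h_{\frac12+n})=a_1^nf_1(n)+\dots+a_\ell^nf_\ell(n)$ for all $n\in\mathbb Z$. *)

(* Defs.v *)
From HB Require Import structures.
From mathcomp Require Import all_boot all_order all_algebra.
From mathcomp Require Import complex.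
From mathcomp Require Import Rstruct.
Set Implicit Arguments. Unset Strict Implicit. Unset Printing Implicit Defensive.
Import Order.TTheory GRing.Theory Num.Theory.
Local Open Scope ring_scope.

Definition C : fieldType := Rdefinitions.R[i].

(*   gH n  = h_{n + 1/2}  (n : int), i.e. h_r with r = 1/2 + n         *)
Inductive gen := gD of int | gH of int | gC | gL.

Definition gen_code (g : gen) : (int + int) + bool :=
  match g with gD m => inl (inl m) | gH n => inl (inr n) | gC => inr true | gL => inr false end.
Definition gen_decode (x : (int + int) + bool) : gen :=
  match x with inl (inl m) => gD m | inl (inr n) => gH n | inr true => gC | inr false => gL end.
Lemma gen_codeK : cancel gen_code gen_decode. Proof. by case. Qed.
HB.instance Definition _ := Equality.copy gen (can_type gen_codeK).

Definition half (n : int) : C := n%:~R + 2%:R^-1.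

(* Coefficient of the basis vector z in the bracket [x, y] of D:
   [d_m,d_n] = (m-n) d_{m+n} + (m^3-m)/12 delta_{m+n,0} c
   [d_m,h_r] = -r h_{m+r}      (so [h_r,d_m] = r h_{m+r})
   [h_r,h_s] = r delta_{r+s,0} l
   c, l central. *)
Definition br (x y z : gen) : C :=
  match x, y, z with
  | gD m, gD n, gD k => if k == m + n then (m - n)%:~R else 0
  | gD m, gD n, gC => if m + n == 0 then (m ^+ 3 - m)%:~R / 12%:R else 0
  | gD m, gH n, gH k => if k == m + n then - half n else 0
  | gH n, gD m, gH k => if k == m + n then half n else 0
  | gH n, gH k, gL => if n + k == -1 then half n else 0
  | _, _, _ => 0
  end.

(* The tensor (free associative) algebra T on the basis of D: elements *)
(* are finitely supported functions  seq gen -> C  (coefficients of    *)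
(* words).  U(D) = T / (x y - y x - [x,y]) and                         *)
(* W(phi) = U(D) (x)_{U(p)} C w_phi = T / J  where J is the left ideal *)
(* spanned by the two-sided Lie relations and by  a (p - phi(p)).      *)
Definition tens := seq gen -> C.

Definition fin_supp (f : tens) : Prop :=
  exists s : seq (seq gen), forall w, f w != 0 -> w \in s.

Definition ew (w : seq gen) : tens := fun u => (u == w)%:R.

Definition lmul (g : gen) (f : tens) : tens :=
  fun u => match u with g' :: u' => if g' == g then f u' else 0 | [::] => 0 end.

Definition in_span (S : tens -> Prop) (f : tens) : Prop :=
  exists (k : nat) (cs : 'I_k -> C) (fs : 'I_k -> tens),
    (forall i, S (fs i)) /\ forall w, f w = \sum_(i < k) cs i * fs i w.

(* e_u * (x y - y x - [x,y]) * e_v *)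
Definition lie_rel (u : seq gen) (x y : gen) (v : seq gen) : tens :=
  fun w => ew (u ++ x :: y :: v) w - ew (u ++ y :: x :: v) w
    - (if (size w == size u + 1 + size v)%N && (take (size u) w == u)
            && (drop (size u).+1 w == v)
       then br x y (nth gC w (size u)) else 0).

(* A Lie algebra homomorphism phi : p -> C, p = C c (+) H,             *)
(* H = span{h_r, l}, is given by its values on the basis of p:          *)
(*   phic = phi(c), phil = phi(l), phih n = phi(h_{1/2+n}),             *)
(* and it must vanish on brackets [p,p] (C is abelian).                 *)
Definition in_p (x : gen) : Prop := x = gC \/ x = gL \/ exists n, x = gH n.

(* For x, y in the basis of p, [x,y] lies in C l (br x y z = 0 unless
   z = gL), so phi([x,y]) = br x y gC * phi(c) + br x y gL * phi(l). *)
Definition phi_is_lie_hom (phic phil : C) (phih : int -> C) : Prop :=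
  forall x y : gen, in_p x -> in_p y -> br x y gC * phic + br x y gL * phil = 0.

Definition phi_H_nonzero (phil : C) (phih : int -> C) : Prop :=
  phil != 0 \/ exists n, phih n != 0.

Definition phi_val (phic phil : C) (phih : int -> C) (x : gen) : C :=
  match x with gC => phic | gL => phil | gH n => phih n | gD _ => 0 end.

Definition ind_rel (phic phil : C) (phih : int -> C) (u : seq gen) (x : gen) : tens :=
  fun w => ew (u ++ [:: x]) w - phi_val phic phil phih x * ew u w.

(* J = kernel of T -> W(phi) *)
Definition Jrel (phic phil : C) (phih : int -> C) : tens -> Prop :=
  in_span (fun f => (exists u x y v, f = lie_rel u x y v) \/
                    (exists u x, in_p x /\ f = ind_rel phic phil phih u x)).

(* D-submodules of W(phi) = T/J correspond to subspaces S of T with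
   J <= S <= T stable under the action (left multiplication) of the
   basis elements of D. *)
Definition is_submodule_pre (J S : tens -> Prop) : Prop :=
  [/\ forall f, S f -> fin_supp f,
      forall f, J f -> S f,
      forall f g, S f -> S g -> S (fun w => f w + g w),
      forall (a : C) f, S f -> S (fun w => a * f w)
    & forall x f, S f -> S (lmul x f)].

Definition W_irreducible (phic phil : C) (phih : int -> C) : Prop :=
  let J := Jrel phic phil phih in
  ~ J (ew [::]) /\
  forall S, is_submodule_pre J S ->
    (forall f, S f <-> J f) \/ (forall f, S f <-> fin_supp f).

Definition exp_polynomial (phih : int -> C) : Prop :=
  exists (l : nat) (a : 'I_l -> C) (f : 'I_l -> {poly C}),
    injective a /\ (forall i, a i != 0) /\
    forall n : int, phih n = \sum_(i < l) a i ^ n * (f i).[n%:~R].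

(* Main.v *)
(** The relations force phi(l) = 0.

    If phi is not an exp-polynomial, the functionals d_m |-> phi(h_(m+r)) on
    Span{d_m} have no common kernel.  The operator h_r - phi(h_r) lowers the
    length of a monomial in the d's by one, acting on leading terms as the
    derivation d_m |-> r phi(h_(m+r)); hence from an element of W(phi) which is
    not zero, suitable products of such operators produce a nonzero multiple of
    the cyclic vector.  Working with all tuples of operators at once, this needs
    only that monomials span W(phi), not that they are independent.

    If phi is an exp-polynomial, then sum_j q_j phi(h_(j+r)) = 0 for all r, with
    q_0 <> 0, and x = sum_j q_j d_j satisfies [x, h_r] w = 0.  To see that
    x - lam generates a proper nonzero submodule for a suitable lam, D is made to
    act on the dual of the polynomial ring C[u_n, x_n, z] by vector fields plus
    multiplication by (m+1) u_m; the last term realizes the Virasoro cocycle.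
    Evaluation at a point with x_n = phi(h_(n+1/2)) and z = phi(c) is a vector of
    character phi; its u-coordinates may be chosen such that it is an eigenvector
    of x, and changing u_0 changes the value of x on it. *)
From HB Require Import structures.
From mathcomp Require Import all_boot all_order all_algebra.
From mathcomp Require Import complex Rstruct boolp ring zify.
Require Import Defs.
Set Implicit Arguments. Unset Strict Implicit. Unset Printing Implicit Defensive.
Import Order.TTheory GRing.Theory Num.Theory.
Local Open Scope ring_scope.

Lemma natC_eq0 (n : nat) : (n%:R == 0 :> C) = (n == 0)%N.
Proof. exact: (@pnatr_eq0 Rdefinitions.R[i] n). Qed.

Lemma intC_eq0 (n : int) : (n%:~R == 0 :> C) = (n == 0).
Proof. exact: (@intr_eq0 Rdefinitions.R[i] n). Qed.

Lemma poly_normalC (p : {poly C}) :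
  {r : seq C | p = lead_coef p *: \prod_(z <- r) ('X - z%:P)}.
Proof. exact: (@closed_field_poly_normal Rdefinitions.R[i] p). Qed.

(* Otherwise unification replaces [C] by [R[i]] and finds its structures over R. *)
Opaque C.

(* [tens] is convertible to [vec (seq gen)]. *)
Section FunctionSpace.
Variable T : Type.

Definition vec : Type := T -> C.
HB.instance Definition _ := gen_eqMixin vec.
HB.instance Definition _ := gen_choiceMixin vec.

Definition vadd (f g : vec) : vec := fun w => f w + g w.
Definition vopp (f : vec) : vec := fun w => - f w.
Definition vzero : vec := fun _ => 0.
Definition vscale (a : C) (f : vec) : vec := fun w => a * f w.

Lemma vaddA : associative vadd.
Proof. by move=> f g h; apply/funext=> w; exact: addrA. Qed.

Lemma vaddC : commutative vadd.
Proof. by move=> f g; apply/funext=> w; exact: addrC. Qed.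

Lemma vadd0 : left_id vzero vadd.
Proof. by move=> f; apply/funext=> w; exact: add0r. Qed.

Lemma vaddN : left_inverse vzero vopp vadd.
Proof. by move=> f; apply/funext=> w; exact: addNr. Qed.

HB.instance Definition _ := GRing.isZmodule.Build vec vaddA vaddC vadd0 vaddN.

Lemma vscaleA a b f : vscale a (vscale b f) = vscale (a * b) f.
Proof. by apply/funext=> w; exact: mulrA. Qed.

Lemma vscale1 : left_id 1 vscale.
Proof. by move=> f; apply/funext=> w; exact: mul1r. Qed.

Lemma vscaleDr : right_distributive vscale +%R.
Proof. by move=> a f g; apply/funext=> w; exact: mulrDr. Qed.

Lemma vscaleDl f : {morph vscale^~ f : a b / a + b}.
Proof. by move=> a b; apply/funext=> w; exact: mulrDl. Qed.

HB.instance Definition _ := GRing.Zmodule_isLmodule.Build C vec vscaleA vscale1 vscaleDr vscaleDl.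

Lemma vecD (f g : vec) w : (f + g) w = f w + g w.
Proof. by []. Qed.

Lemma vecN (f : vec) w : (- f) w = - f w.
Proof. by []. Qed.

Lemma vec0 w : (0 : vec) w = 0.
Proof. by []. Qed.

Lemma vecZ (a : C) (f : vec) w : (a *: f) w = a * f w.
Proof. by []. Qed.

Lemma vec_sum I (r : seq I) (P : pred I) (F : I -> vec) w :
  (\sum_(i <- r | P i) F i) w = \sum_(i <- r | P i) F i w.
Proof. exact: (big_morph (fun f : vec => f w)). Qed.
End FunctionSpace.

Definition vecE := (vecD, vecN, vec0, vecZ).
Local Notation T := (vec (seq gen)).

Lemma half_neq0 n : half n != 0.
Proof.
have h2 : 2%:R != 0 :> C by rewrite natC_eq0.
have -> : half n = (2 * n + 1)%:~R / 2%:R by rewrite /half rmorphD rmorphM /=; field.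
rewrite mulf_neq0 ?invr_eq0 // intC_eq0; lia.
Qed.

(** * Linear recurrences and exp-polynomials *)

(** The operator p(E), where E is the shift n -> n + 1; by [shiftpM], sequences on the integers
    become a module over C[t]. *)
Definition shiftp (p : {poly C}) (f : int -> C) : int -> C :=
  fun n => \sum_(i < size p) p`_i * f (n + i%:Z).

Lemma shiftp_wide N (p : {poly C}) f n : (size p <= N)%N ->
  shiftp p f n = \sum_(i < N) p`_i * f (n + i%:Z).
Proof.
move=> leN; rewrite /shiftp (big_ord_widen _ (fun i => p`_i * f (n + i%:Z)) leN).
rewrite big_mkcond; apply: eq_bigr => i _ /=.
by case: ltnP => // ge; rewrite nth_default // mul0r.
Qed.

Arguments shiftp_wide {N p f n}.

Lemma shiftpD (p q : {poly C}) f n : shiftp (p + q) f n = shiftp p f n + shiftp q f n.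
Proof.
have szD := size_polyD p q.
rewrite (shiftp_wide (N := maxn (size p) (size q))) //.
rewrite (shiftp_wide (p := p) (leq_maxl _ (size q))).
rewrite (shiftp_wide (p := q) (leq_maxr (size p) _)) -big_split /=.
by apply: eq_bigr => i _; rewrite coefD mulrDl.
Qed.

Lemma shiftpZ a p f n : shiftp (a *: p) f n = a * shiftp p f n.
Proof.
rewrite (shiftp_wide (size_scale_leq a p)) big_distrr /=.
by apply: eq_bigr => i _; rewrite coefZ mulrA.
Qed.

Lemma shiftpC a f n : shiftp a%:P f n = a * f n.
Proof.
rewrite (shiftp_wide (size_polyC_leq1 a)) big_ord_recl big_ord0 coefC /=.
by rewrite !addr0.
Qed.

Lemma shiftpMX p f n : shiftp (p * 'X) f n = shiftp p f (n + 1).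
Proof.
rewrite (shiftp_wide (N := (size p).+1)); last first.
  by apply: leq_trans (size_polyMleq _ _) _; rewrite size_polyX; lia.
rewrite big_ord_recl coefMX /= mul0r add0r; apply: eq_bigr => i _.
by rewrite coefMX /=; congr (_ * f _); rewrite /bump /=; lia.
Qed.

Lemma shiftpM p q f n : shiftp (p * q) f n = shiftp p (shiftp q f) n.
Proof.
elim/poly_ind: p n => [|p c IH] n.
  by rewrite mul0r /shiftp size_poly0 !big_ord0.
rewrite mulrDl !shiftpD -mulrA [_ * q]mulrC mulrA !shiftpMX IH mul_polyC.
by rewrite shiftpZ shiftpC.
Qed.

Lemma shiftpXsubC a f n : shiftp ('X - a%:P) f n = f (n + 1) - a * f n.
Proof.
have -> : 'X - a%:P = 1%:P * 'X + (- a)%:P by rewrite polyC1 mul1r polyCN.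
by rewrite shiftpD shiftpMX !shiftpC mul1r mulNr.
Qed.

Lemma shiftp_fD p f g n : shiftp p (fun m => f m + g m) n = shiftp p f n + shiftp p g n.
Proof. by rewrite /shiftp -big_split; apply: eq_bigr => i _; rewrite mulrDr. Qed.

Lemma shiftp0 p n : shiftp p (fun=> 0) n = 0.
Proof. by rewrite /shiftp big1 // => i _; rewrite mulr0. Qed.

Lemma eq_shiftp p f g : f =1 g -> shiftp p f =1 shiftp p g.
Proof. by move=> fg n; apply: eq_bigr => i _; rewrite fg. Qed.

Definition linear_factors (s : seq C) : {poly C} := \prod_(a <- s) ('X - a%:P).

(** Roots are kept as a list, so that multiplying recurrences is concatenation. As 0 is not a root,
    the recurrence can be solved in both directions. *)
Definition recurrent (f : int -> C) : Prop :=
  exists2 s, 0 \notin s & forall n, shiftp (linear_factors s) f n = 0.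

Lemma recurrentD f g : recurrent f -> recurrent g -> recurrent (fun n => f n + g n).
Proof.
move=> [s s0 fs] [t t0 gt]; exists (s ++ t).
  by rewrite mem_cat negb_or s0.
move=> n; rewrite /linear_factors big_cat /= shiftp_fD.
rewrite addrC shiftpM (eq_shiftp _ gt) shiftp0 add0r.
by rewrite mulrC shiftpM (eq_shiftp _ fs) shiftp0.
Qed.

(** Translation by 1 preserves the degree and the leading coefficient, so the top terms cancel. *)
Lemma size_shift_sub (f : {poly C}) : f != 0 ->
  (size (f \Po ('X + 1%:P) - f)%R < size f)%N.
Proof.
move=> f0; have sz : size (f \Po ('X + 1%:P)) = size f.
  by rewrite size_comp_poly2 // size_XaddC.
have f1 : (0 < size f)%N by rewrite size_poly_gt0.
have le : (size (f \Po ('X + 1%:P) - f)%R <= size f)%N.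
  by apply: leq_trans (size_polyD _ _) _; rewrite size_polyN sz maxnn.
rewrite ltn_neqAle le andbT; apply/eqP => e.
have : lead_coef (f \Po ('X + 1%:P) - f) != 0.
  by rewrite lead_coef_eq0 -size_poly_eq0 e -lt0n.
rewrite lead_coefE e coefB -{1}sz -!lead_coefE lead_coef_comp ?size_XaddC //.
by rewrite lead_coefXaddC expr1n mulr1 subrr eqxx.
Qed.

(** E - a sends a^n f(n) to a^(n+1) (f(n+1) - f(n)), lowering the degree of f; hence (E - a)^(size
    f) annihilates the sequence. *)
Lemma recurrent_expM (a : C) (f : {poly C}) : a != 0 ->
  recurrent (fun n => a ^ n * f.[n%:~R]).
Proof.
move=> a0; exists (nseq (size f) a); first by rewrite mem_nseq eq_sym (negbTE a0) andbF.
elim: {f}(size f).+1 {-2}f (ltnSn (size f)) => // k IH f szf n.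
have [->|f0] := eqVneq f 0.
  by rewrite size_poly0 /linear_factors big_nil -polyC1 shiftpC horner0 !mulr0.
pose g := f \Po ('X + 1%:P) - f; have ltg : (size g < size f)%N := size_shift_sub f0.
case E: (size f) (f0) => [|m]; first by rewrite -size_poly_eq0 E.
move=> _; rewrite /= /linear_factors big_cons mulrC shiftpM.
have eg : shiftp ('X - a%:P) (fun n => a ^ n * f.[n%:~R]) =1
          (fun n => a ^ n * (a *: g).[n%:~R]).
  move=> i; rewrite shiftpXsubC expfzDr // expr1z hornerZ /g hornerD hornerN.
  by rewrite horner_comp hornerD hornerX hornerC rmorphD /=; ring.
rewrite (eq_shiftp _ eg).
have szg : (size (a *: g)%R <= m)%N.
  by rewrite size_scale // -ltnS -E.
(* The size may drop by more than one: [size (a *: g)] factors already give zero, and the surplus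
   ones act on zero. *)
rewrite -[nseq m a](cat_take_drop (m - size (a *: g)%R)%N).
rewrite big_cat /= shiftpM (@eq_shiftp _ _ (fun=> 0)) ?shiftp0 // => i.
by rewrite drop_nseq subKn // IH //; lia.
Qed.

Lemma exp_polynomial_recurrent f : exp_polynomial f -> recurrent f.
Proof.
move=> [l [a [q [_ [a0 fE]]]]].
have /funext-> : f =1 fun n => \sum_(i < l) a i ^ n * (q i).[n%:~R] by [].
elim: l a q a0 {fE} => [|l IH] a q a0.
  exists [::] => // n; rewrite (@eq_shiftp _ _ (fun=> 0)) ?shiftp0 // => i.
  by rewrite big_ord0.
have /funext-> : (fun n : int => \sum_(i < l.+1) a i ^ n * (q i).[n%:~R]) =1
   (fun n => a ord0 ^ n * (q ord0).[n%:~R] +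
      \sum_(i < l) a (lift ord0 i) ^ n * (q (lift ord0 i)).[n%:~R]).
  by move=> n; rewrite big_ord_recl.
apply: recurrentD; first exact: recurrent_expM.
by apply: IH => i.
Qed.

Lemma shiftpXsubC_surj a (b : int -> C) : a != 0 ->
  exists u, forall n, shiftp ('X - a%:P) u n = b n.
Proof.
move=> a0.
(* Starting from u(0) = 0, the equation u(n+1) = a u(n) + b(n) is solved upwards by [up] and
   downwards by [dn], where [dn k] is the value at -(k+1). *)
pose up := fix up k := if k is k'.+1 then a * up k' + b k'%:Z else 0.
pose dn := fix dn k := ((if k is k'.+1 then dn k' else up 0%N) - b (Negz k)) / a.
exists (fun n => match n with Posz k => up k | Negz k => dn k end) => n.
rewrite shiftpXsubC; case: n => [k|[|k]].
- by rewrite -PoszD addn1 /= addrC addKr.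
- by rewrite (_ : Negz 0 + 1 = Posz 0) //= mulrC divfK // opprB addrC subrK.
- rewrite (_ : Negz k.+1 + 1 = Negz k); last by rewrite !NegzE; lia.
  by rewrite [dn k.+1]/= [a * _]mulrC divfK // opprB addrC subrK.
Qed.

Lemma shiftp_surj s (b : int -> C) : 0 \notin s ->
  exists u, forall n, shiftp (linear_factors s) u n = b n.
Proof.
elim: s b => [|a s IH] b; rewrite ?inE ?negb_or.
  by exists b => n; rewrite /linear_factors big_nil -polyC1 shiftpC mul1r.
case/andP=> a0 s0; rewrite eq_sym in a0.
have [v vE] := shiftpXsubC_surj b a0; have [u uE] := IH v s0.
by exists u => n; rewrite /linear_factors big_cons shiftpM (eq_shiftp _ uE) vE.
Qed.

(** * Twisted difference equations for polynomials *)

Section TwistedDifference.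
Variables (a b : C).
Hypothesis b0 : b != 0.

Let solvable (f : {poly C}) :=
  exists g : {poly C}, forall x, b * g.[x + 1] - a * g.[x] = f.[x].

Let solvable0 : solvable 0.
Proof. by exists 0 => x; rewrite !horner0 !mulr0 subrr. Qed.

Let solvableD f g : solvable f -> solvable g -> solvable (f + g).
Proof.
move=> [f' fE] [g' gE]; exists (f' + g') => x.
by rewrite !hornerD -fE -gE; ring.
Qed.

Let solvableZ c f : solvable f -> solvable (c *: f).
Proof. by move=> [g gE]; exists (c *: g) => x; rewrite !hornerZ -gE; ring. Qed.

Let solvable_lower n m : (forall i, (i < n)%N -> solvable 'X^i) ->
  solvable (\sum_(i < n) 'C(m, i)%:R *: 'X^i).
Proof. by move=> h; elim/big_ind: _ => // i _; apply/solvableZ/h. Qed.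

Let horner_lower n m x : (\sum_(i < n) 'C(m, i)%:R *: 'X^i : {poly C}).[x] =
  \sum_(i < n) x ^+ i *+ 'C(m, i).
Proof.
by rewrite horner_sum; apply: eq_bigr => i _; rewrite hornerZ hornerXn mulr_natl.
Qed.

(** For a <> b, the monomial x^n is sent to (b - a) x^n plus lower terms, which are solvable by
    induction. For a = b the degree drops by one, so the solution starts from x^(n+1), which is sent
    to b (n+1) x^n plus lower terms. *)
Let solvableXn n : solvable 'X^n.
Proof.
elim/ltn_ind: n => n IH; have [eab|nab] := eqVneq a b.
- have [g gE] := solvable_lower n.+1 IH.
  have n0 : n.+1%:R != 0 :> C by rewrite natC_eq0.
  exists ((b^-1 * n.+1%:R^-1) *: ('X^(n.+1) - b *: g)) => x.
  have e := gE x; rewrite horner_lower eab in e.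
  rewrite !(hornerE, hornerXn) /= exprD1n !big_ord_recr /= binn binSn -e eab.
  by rewrite -mulr_natr mulr1n; field; rewrite addrC natr1 n0.
- have [g gE] := solvable_lower n IH.
  have n0 : b - a != 0 by rewrite subr_eq0 eq_sym.
  exists ((b - a)^-1 *: ('X^n - b *: g)) => x.
  have e := gE x; rewrite horner_lower in e.
  rewrite !(hornerE, hornerXn) /= exprD1n !big_ord_recr /= binn -e.
  by rewrite mulr1n; field.
Qed.

(** Equivalently, E - a is surjective on the sequences b^n g(n) with g a polynomial, since it sends
    such a sequence to b^n (b g(n+1) - a g(n)). *)
Lemma twisted_difference_surj (f : {poly C}) :
  exists g : {poly C}, forall x, b * g.[x + 1] - a * g.[x] = f.[x].
Proof.
rewrite -[f]coefK poly_def -/(solvable _); elim/big_ind: _ => // i _.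
exact: solvableZ.
Qed.
End TwistedDifference.

(** Bases may repeat, so that terms can simply be added to the list; [exp_sum_polynomial] merges
    equal bases. *)
Definition exp_sum (L : seq (C * {poly C})) (n : int) : C :=
  \sum_(p <- L) p.1 ^ n * p.2.[n%:~R].

Lemma exp_sum_polynomial L : all (fun p => p.1 != 0) L ->
  exp_polynomial (exp_sum L).
Proof.
move=> L0; pose u := undup [seq p.1 | p <- L].
exists (size u), (fun i => u`_i), (fun i => \sum_(p <- L | p.1 == u`_i) p.2).
split; first by move=> i j /eqP; rewrite nth_uniq ?undup_uniq // => /eqP/val_inj.
split=> [i|n].
  have : u`_i \in u by rewrite mem_nth.
  by rewrite mem_undup => /mapP[p /(allP L0) p0 ->].
transitivity (\sum_(a <- u) a ^ n * (\sum_(p <- L | p.1 == a) p.2).[n%:~R]); last first.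
  by rewrite (big_nth 0) big_mkord.
under eq_bigr => a _ do rewrite horner_sum big_distrr /=.
rewrite (exchange_big_dep predT) //= /exp_sum; apply: eq_big_seq => p pL.
rewrite (big_rem p.1) /= ?eqxx; last by rewrite mem_undup map_f.
rewrite big_seq_cond big1 ?addr0 // => a /andP[].
by rewrite mem_rem_uniq ?undup_uniq // inE => /andP[/negP h _] /eqP e; case: h; rewrite e.
Qed.

(** The factor [(a != 0)%:R] accounts for a = 0, where f(n+1) = 0 for every integer n forces f =
    0. *)
Lemma geometric a f : (forall n, shiftp ('X - a%:P) f n = 0) ->
  forall n : int, f n = (f 0 * (a != 0)%:R) * a ^ n.
Proof.
move=> f0; have fS n : f (n + 1) = a * f n.
  by apply/eqP; rewrite -subr_eq0 -shiftpXsubC f0.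
have [ea|a0] := eqVneq a 0.
  by move=> n; rewrite mulr0 mul0r -[n](subrK 1) fS ea mul0r.
move=> n; rewrite mulr1; elim: n => [|n IH|n IH]; first by rewrite expr0z mulr1.
- by rewrite -addn1 PoszD fS IH expfzDr // expr1z; ring.
- apply: (mulfI a0); rewrite -fS (_ : _ + 1 = - n%:Z); last by lia.
  by rewrite IH mulrCA (_ : - n%:Z = 1 + - n.+1%:Z) ?expfzDr ?expr1z //; lia.
Qed.

(** Induction on the roots: (E - a) f is an exponential sum L, some exponential sum M satisfies (E -
    a) M = L, and f - M is killed by E - a, hence geometric. *)
Lemma recurrence_exp_sum s f : (forall n, shiftp (linear_factors s) f n = 0) ->
  exists2 L, all (fun p => p.1 != 0) L & f =1 exp_sum L.
Proof.
elim: s f => [|a s IH] f fs.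
  exists [::] => // n; rewrite /exp_sum big_nil.
  by have := fs n; rewrite /linear_factors big_nil -polyC1 shiftpC mul1r.
have [n|L L0 LE] := IH (shiftp ('X - a%:P) f).
  by rewrite -shiftpM mulrC -(fs n) /linear_factors big_cons.
have [M M0 ME] : exists2 M, all (fun p => p.1 != 0) M &
    forall n, shiftp ('X - a%:P) (exp_sum M) n = exp_sum L n.
  elim: L L0 {LE} => [|[b q] L IHL] /=.
    exists [::] => // n; rewrite /exp_sum (@eq_shiftp _ _ (fun=> 0)) ?shiftp0 ?big_nil //.
    by move=> i; rewrite big_nil.
  case/andP=> b0 /IHL[M M0 ME]; have [g gE] := twisted_difference_surj a b0 q.
  exists ((b, g) :: M) => [|n]; first by rewrite /= b0.
  rewrite {2}/exp_sum big_cons -/(exp_sum L n) -ME /= -gE !shiftpXsubC.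
  rewrite /exp_sum !big_cons /= expfzDr // expr1z rmorphD /=; ring.
have ker n : shiftp ('X - a%:P) (fun m => f m - exp_sum M m) n = 0.
  have := LE n; rewrite -ME !shiftpXsubC => e.
  transitivity ((f (n + 1) - a * f n) - (exp_sum M (n + 1) - a * exp_sum M n)); first by ring.
  by rewrite e subrr.
have fE := geometric ker.
(* For a = 0 the new term is zero and gets the dummy base 1, since all bases must be nonzero. *)
exists ((if a == 0 then 1 else a, (if a == 0 then 0 else (f 0 - exp_sum M 0)%:P)) :: M).
  by rewrite /= M0 andbT; case: (eqVneq a 0) => [_|//]; rewrite oner_neq0.
move=> n; rewrite /exp_sum big_cons -/(exp_sum M n) /= -[LHS](subrK (exp_sum M n)) fE.
congr (_ + _); case: eqVneq => [_|_] /=; first by rewrite mulr0 mul0r horner0 mulr0.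
by rewrite hornerC mulr1 mulrC.
Qed.

Lemma recurrence_exp_polynomial (q : {poly C}) f : q != 0 ->
  (forall n, shiftp q f n = 0) -> exp_polynomial f.
Proof.
move=> q0 fq; have [s qE] := poly_normalC q.
have [n|L L0 LE] := @recurrence_exp_sum s f.
  have := fq n; rewrite qE shiftpZ => /eqP.
  by rewrite mulf_eq0 lead_coef_eq0 (negbTE q0) => /eqP.
rewrite (funext LE); exact: exp_sum_polynomial.
Qed.

(** A relation with nonzero total coefficient at some m amounts to a recurrence q(E) f = 0 with q <>
    0, which makes f an exp-polynomial. *)
Lemma shift_independent f (L : seq (C * int)) : ~ exp_polynomial f ->
  (forall n, \sum_(p <- L) p.1 * f (p.2 + n) = 0) ->
  forall m, \sum_(p <- L | p.2 == m) p.1 = 0.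
Proof.
move=> nf rel m; apply/eqP/negPn/negP => nz; apply: nf.
(* Adding N makes m and all shifts in L nonnegative, so that they can serve as exponents in q. *)
pose N := (`|m| + \sum_(p <- L) `|p.2|)%N.
have leN p : p \in L -> (`|p.2| <= N)%N.
  by move=> pL; rewrite /N (big_rem p) //=; lia.
pose e (p : C * int) := absz (p.2 + N%:Z).
have eE p : p \in L -> (e p)%:Z = p.2 + N%:Z.
  by move/leN; rewrite /e; move: (p.2) (N) => k N0; lia.
pose q : {poly C} := \sum_(p <- L) p.1 *: 'X^(e p).
apply: (@recurrence_exp_polynomial q) => [|n].
  apply: contra nz => /eqP/(congr1 (fun r : {poly C} => r`_(absz (m + N%:Z)))).
  rewrite coef0 coef_sum => e0; rewrite -[X in _ == X]e0 big_mkcond /=.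
  apply/eqP/eq_big_seq => p /eE eEp; rewrite coefZ coefXn.
  have -> : (absz (m + N%:Z) == e p) = (p.2 == m) by rewrite /N in eEp *; lia.
  by case: eqP; rewrite ?mulr1 ?mulr0.
rewrite -(rel (n + N%:Z)) /q; have : all (fun p => (e p)%:Z == p.2 + N%:Z) L.
  by apply/allP => p /eE ->.
elim: (L) => [|p L' IH] /=; first by rewrite !big_nil -[0]/(0%:P) shiftpC mul0r.
case/andP=> /eqP ep /IH; rewrite !big_cons shiftpD shiftpZ => ->.
congr (_ * _ + _); rewrite -['X^_]mul1r.
have shX k : shiftp (1 * 'X^k) f n = f (n + k%:Z).
  elim: k (n) => [|k IHk] n'; first by rewrite mulr1 -polyC1 shiftpC mul1r addr0.
  by rewrite exprSr mulrA shiftpMX IHk; congr f; lia.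
by rewrite shX ep; congr f; lia.
Qed.

(** * The tensor algebra and its relations *)

Section Span.
Variable S : tens -> Prop.

Lemma in_span_gen (f : T) : S f -> in_span S f.
Proof.
move=> Sf; exists 1%N, (fun=> 1), (fun=> f); split=> // w.
by rewrite big_ord1 mul1r.
Qed.

Lemma in_span0 : in_span S (0 : T).
Proof.
by exists 0%N, (fun=> 0), (fun=> (0 : T)); split=> [[]//|w]; rewrite big_ord0.
Qed.

Lemma in_spanD (f g : T) : in_span S f -> in_span S g -> in_span S (f + g).
Proof.
move=> [k [a [u [Su fE]]]] [l [b [v [Sv gE]]]].
exists (k + l)%N, (fun i => match split i with inl j => a j | inr j => b j end).
exists (fun i => match split i with inl j => u j | inr j => v j end).
split=> [i|w]; first by case: (split i).
rewrite big_split_ord vecD fE gE; congr (_ + _); apply: eq_bigr => i _.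
  by rewrite -[lshift _ _]/(unsplit (inl i)) unsplitK.
by rewrite -[rshift _ _]/(unsplit (inr i)) unsplitK.
Qed.

Lemma in_spanZ c (f : T) : in_span S f -> in_span S (c *: f).
Proof.
move=> [k [a [u [Su fE]]]]; exists k, (fun i => c * a i), u; split=> // w.
by rewrite vecZ fE big_distrr /=; apply: eq_bigr => i _; rewrite mulrA.
Qed.

Lemma in_spanN (f : T) : in_span S f -> in_span S (- f).
Proof. by rewrite -scaleN1r; apply: in_spanZ. Qed.

Lemma in_spanB (f g : T) : in_span S f -> in_span S g -> in_span S (f - g).
Proof. by move=> ? ?; apply/in_spanD/in_spanN. Qed.

Lemma in_span_sum (I : eqType) (r : seq I) (P : pred I) (F : I -> T) :
  (forall i, i \in r -> P i -> in_span S (F i)) -> in_span S (\sum_(i <- r | P i) F i).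
Proof.
move=> h; rewrite big_seq_cond; elim/big_ind: _ => [||i /andP[]]; last exact: h.
  exact: in_span0.
exact: in_spanD.
Qed.

Lemma in_span_elim (P : T -> Prop) : P 0 ->
  (forall f g, P f -> P g -> P (f + g)) -> (forall c f, P f -> P (c *: f)) ->
  (forall f, S f -> P f) -> forall f, in_span S f -> P f.
Proof.
move=> P0 PD PZ SP f [k [a [u [Su fE]]]].
have -> : f = \sum_(i < k) a i *: (u i : T).
  by apply/funext => w; rewrite fE vec_sum.
by elim/big_ind: _ => // i _; apply/PZ/SP.
Qed.
End Span.

Lemma in_span_sub S S' (f : T) :
  (forall g, S g -> in_span S' g) -> in_span S f -> in_span S' f.
Proof.
move=> h; apply: in_span_elim => //.
- exact: in_span0.
- exact: in_spanD.
- exact: in_spanZ.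
Qed.

Definition lmulT (g : gen) (f : T) : T := lmul g f.
Definition word (w : seq gen) : T := ew w.

Lemma lmulD g f f' : lmulT g (f + f') = lmulT g f + lmulT g f'.
Proof.
apply/funext => -[|x w]; rewrite vecD /lmulT /= ?addr0 //.
by case: ifP; rewrite ?addr0.
Qed.

Lemma lmulZ g c f : lmulT g (c *: f) = c *: lmulT g f.
Proof.
apply/funext => -[|x w]; rewrite vecZ /lmulT /= ?mulr0 //.
by case: ifP; rewrite ?mulr0.
Qed.

Lemma lmul0 g : lmulT g 0 = 0.
Proof. by apply/funext => -[|x w] //=; rewrite /lmulT /=; case: ifP. Qed.

Lemma lmulB g f f' : lmulT g (f - f') = lmulT g f - lmulT g f'.
Proof. by rewrite lmulD -scaleN1r lmulZ scaleN1r. Qed.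

Lemma lmul_sum g I (r : seq I) (P : pred I) (F : I -> T) :
  lmulT g (\sum_(i <- r | P i) F i) = \sum_(i <- r | P i) lmulT g (F i).
Proof. exact: (big_morph (lmulT g) (lmulD g) (lmul0 g)). Qed.

Lemma lmul_word g w : lmulT g (word w) = word (g :: w).
Proof.
apply/funext => -[|x u]; rewrite /lmulT /word /ew //= eqseq_cons.
by case: eqP.
Qed.

Lemma fin_supp_sum (f : T) : fin_supp f ->
  exists s : seq (seq gen), f = \sum_(w <- s) f w *: word w.
Proof.
move=> [s fs]; exists (undup s); apply/funext => u; rewrite vec_sum.
have [us|us] := boolP (u \in undup s); last first.
  rewrite big_seq big1 => [|w ws].
    by apply/eqP/negPn/negP => /fs; rewrite -mem_undup (negbTE us).
  rewrite vecZ /word /ew; case: eqP => [e|_]; last by rewrite mulr0.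
  by move: us; rewrite e ws.
rewrite (bigD1_seq u) ?undup_uniq //= vecZ /word /ew eqxx mulr1.
rewrite big1 ?addr0 // => w /negbTE wu.
by rewrite vecZ eq_sym wu mulr0.
Qed.

Lemma fin_suppD (f g : T) : fin_supp f -> fin_supp g -> fin_supp (f + g).
Proof.
move=> [s fs] [t gt]; exists (s ++ t) => w; rewrite mem_cat vecD.
have [->|/fs->//] := eqVneq (f w) 0; rewrite add0r => /gt ->; exact: orbT.
Qed.

Lemma fin_suppZ a (f : T) : fin_supp f -> fin_supp (a *: f).
Proof.
by move=> [s fs]; exists s => w; rewrite vecZ mulf_eq0 negb_or => /andP[_ /fs].
Qed.

Lemma fin_suppB (f g : T) : fin_supp f -> fin_supp g -> fin_supp (f - g).
Proof. by move=> ff fg; rewrite -scaleN1r; apply/fin_suppD/fin_suppZ. Qed.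

Lemma fin_supp_word w : fin_supp (word w).
Proof.
exists [:: w] => u; rewrite inE /word /ew.
by case: (u == w); rewrite //= eqxx.
Qed.

Lemma fin_supp0 : fin_supp (0 : T).
Proof. by exists [::] => w; rewrite vec0 eqxx. Qed.

Lemma fin_supp_bigsum I (r : seq I) (F : I -> T) : (forall i, fin_supp (F i)) ->
  fin_supp (\sum_(i <- r) F i).
Proof.
move=> fF; elim/big_ind: _ => //; first exact: fin_supp0.
exact: fin_suppD.
Qed.

Lemma fin_supp_lmul g (f : T) : fin_supp f -> fin_supp (lmulT g f).
Proof.
move=> [s fs]; exists [seq g :: w | w <- s] => -[|x w]; rewrite /lmulT /= ?eqxx //.
by have [->|_] := eqVneq x g; [move/fs/(map_f (cons g))|rewrite eqxx].
Qed.

Definition bracket (x y : gen) : seq (C * gen) :=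
  match x, y with
  | gD m, gD n => [:: ((m - n)%:~R, gD (m + n));
      (if m + n == 0 then (m ^+ 3 - m)%:~R / 12%:R else 0, gC)]
  | gD m, gH n => [:: (- half n, gH (m + n))]
  | gH n, gD m => [:: (half n, gH (m + n))]
  | gH n, gH k => [:: (if n + k == -1 then half n else 0, gL)]
  | _, _ => [::]
  end.

Lemma br_bracket x y z : br x y z = \sum_(p <- bracket x y) p.1 * (z == p.2)%:R.
Proof.
have eD a b : (gD a == gD b) = (a == b) by apply/eqP/eqP => [[]|->].
have eH a b : (gH a == gH b) = (a == b) by apply/eqP/eqP => [[]|->].
case: x => [m|n||]; case: y => [m'|n'||]; rewrite /= ?big_nil ?big_cons ?big_nil;
  case: z => [a|a||] //=; rewrite ?eD ?eH ?mulr0 ?mulr1 ?addr0 ?add0r //;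
  by case: eqP => _; rewrite ?mulr1 ?mulr0.
Qed.

(** A word passing the test in [lie_rel] is u z v for one letter z; this turns the test into an
    explicit combination of words. *)
Lemma lie_relE u x y v : (lie_rel u x y v : T) =
  word (u ++ x :: y :: v) - word (u ++ y :: x :: v)
  - \sum_(p <- bracket x y) p.1 *: word (u ++ p.2 :: v).
Proof.
apply/funext => w; rewrite /lie_rel !vecE vec_sum; congr (_ - _).
case: ifP => [/andP[/andP[/eqP sw /eqP tw] /eqP dw]|].
  have -> : w = u ++ nth gC w (size u) :: v.
    by rewrite -[LHS](cat_take_drop (size u)) tw (drop_nth gC) ?dw //; lia.
  rewrite nth_cat ltnn subnn /= br_bracket; apply: eq_bigr => p _.
  by rewrite vecZ /word /ew eqseq_cat // eqxx eqseq_cons eqxx andbT.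
move=> nw; rewrite big1 // => p _; rewrite vecZ /word /ew.
case: eqP => [e|]; last by rewrite mulr0.
move: nw; rewrite e size_cat /= addn1 addSnnS eqxx take_size_cat // eqxx.
by rewrite -cat_rcons drop_size_cat ?eqxx // size_rcons.
Qed.

Lemma lmul_lie_rel g u x y v : lmulT g (lie_rel u x y v) = lie_rel (g :: u) x y v.
Proof.
rewrite !lie_relE !lmulB lmul_sum !lmul_word.
by under eq_bigr do rewrite lmulZ lmul_word.
Qed.

Lemma lmul_ind_rel phic phil phih g u x :
  lmulT g (ind_rel phic phil phih u x) = ind_rel phic phil phih (g :: u) x.
Proof.
rewrite -[ind_rel _ _ _ u x]/(word (u ++ [:: x]) - phi_val phic phil phih x *: word u).
by rewrite lmulB lmulZ !lmul_word.
Qed.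

(** * Irreducibility *)

Section Whittaker.
Variables (phic : C) (phih : int -> C).
Let J := Jrel phic 0 phih.
Let phi := phi_val phic 0 phih.

(** The generating relations have an arbitrary left factor [u], which absorbs g. *)
Lemma J_lmul g (f : T) : J f -> J (lmulT g f).
Proof.
move: f; apply: (@in_span_elim _ (fun f => J (lmulT g f))).
- by rewrite lmul0; apply: in_span0.
- by move=> f1 f2 ? ?; rewrite lmulD; apply: in_spanD.
- by move=> c f1 ?; rewrite lmulZ; apply: in_spanZ.
move=> f [[u [x [y [v ->]]]]|[u [x [px ->]]]]; apply: in_span_gen; [left|right].
  by rewrite lmul_lie_rel; exists (g :: u), x, y, v.
by rewrite lmul_ind_rel; exists (g :: u), x.
Qed.

Lemma J_bracket x y v : J (word (x :: y :: v) - word (y :: x :: v)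
  - \sum_(p <- bracket x y) p.1 *: word (p.2 :: v)).
Proof.
apply: in_span_gen; left; exists [::], x, y, v.
by rewrite -[RHS]/(_ : T) lie_relE.
Qed.

Lemma J_ind x : in_p x -> J (word [:: x] - phi x *: word [::]).
Proof. by move=> px; apply: in_span_gen; right; exists [::], x. Qed.

(** * Filtration of W(phi) by the number of d's *)

Definition dword (v : seq int) : T := word (map gD v).

(** The preimage in the tensor algebra of the span of the monomials with fewer than k letters d_m.
    The strict bound makes [filt 0] equal to J. *)
Definition filt k : tens -> Prop :=
  in_span (fun f => J f \/ exists2 v, (size v < k)%N & f = dword v).

Lemma filt0 f : filt 0 f -> J f.
Proof. by apply: in_span_sub => g [//|[]]. Qed.

Lemma filt_J k f : J f -> filt k f.
Proof. by move=> Jf; apply: in_span_gen; left. Qed.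

Lemma filt_dword k v : (size v < k)%N -> filt k (dword v).
Proof. by move=> lt; apply: in_span_gen; right; exists v. Qed.

Lemma filt_mono k l (f : T) : (k <= l)%N -> filt k f -> filt l f.
Proof.
move=> le; apply: in_span_sub => g [|[v lt ->]]; first exact: filt_J.
by apply: filt_dword; apply: leq_trans le.
Qed.

Lemma filt_lmulD k m (f : T) : filt k f -> filt k.+1 (lmulT (gD m) f).
Proof.
move: f; apply: (@in_span_elim _ (fun f => filt k.+1 (lmulT (gD m) f))).
- by rewrite lmul0; apply: in_span0.
- by move=> f1 f2 ? ?; rewrite lmulD; apply: in_spanD.
- by move=> c f1 ?; rewrite lmulZ; apply: in_spanZ.
move=> g [Jg|[v lt ->]]; first exact/filt_J/J_lmul.
by rewrite lmul_word; apply: (@filt_dword _ (m :: v)).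
Qed.

Definition shiftE r (f : T) : T := lmulT (gH r) f - phih r *: f.

Lemma shiftED r f g : shiftE r (f + g) = shiftE r f + shiftE r g.
Proof. by rewrite /shiftE lmulD scalerDr opprD addrACA. Qed.

Lemma shiftEZ r c f : shiftE r (c *: f) = c *: shiftE r f.
Proof. by rewrite /shiftE lmulZ scalerBr !scalerA mulrC. Qed.

Lemma shiftE0 r : shiftE r 0 = 0.
Proof. by rewrite /shiftE lmul0 scaler0 subr0. Qed.

Lemma shiftE_J r f : J f -> J (shiftE r f).
Proof. by move=> Jf; apply: in_spanB; [apply: J_lmul|apply: in_spanZ]. Qed.

(** One entry per position: the removed letter and the remaining word. A derivation with scalar
    values c_m on d_m sends v to the sum of c_(p.1) times [p.2]. *)
Fixpoint dels (v : seq int) : seq (int * seq int) :=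
  if v is n :: v' then (n, v') :: [seq (p.1, n :: p.2) | p <- dels v'] else [::].

Lemma size_dels v p : p \in dels v -> size v = (size p.2).+1.
Proof.
elim: v p => //= n v IH p; rewrite inE => /predU1P[->//|/mapP[q /IH -> ->]] //.
Qed.

Lemma shiftE_lmulD r m v : J (shiftE r (dword (m :: v))
  - lmulT (gD m) (shiftE r (dword v)) - half r *: lmulT (gH (m + r)) (dword v)).
Proof.
have := J_bracket (gH r) (gD m) (map gD v).
rewrite big_seq1 /= /shiftE /dword lmulB lmulZ !lmul_word.
by congr (in_span _ _); rewrite opprB addrA subrK.
Qed.

(** Moving [gH r] past the first letter [gD m] leaves [half r] times [gH (m + r)] on the shorter
    word. This acts as [phih (m + r)] plus [shiftE (m + r)], and the latter lowers the length once
    more. *)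
Lemma shiftE_dword r v : filt (size v).-1
  (shiftE r (dword v) - \sum_(p <- dels v) (half r * phih (r + p.1)) *: dword p.2)
  /\ filt (size v) (shiftE r (dword v)).
Proof.
suff h : forall r, filt (size v).-1
  (shiftE r (dword v) - \sum_(p <- dels v) (half r * phih (r + p.1)) *: dword p.2).
  split=> //; rewrite -(subrK (\sum_(p <- dels v) (half r * phih (r + p.1)) *: dword p.2)
     (shiftE r (dword v))).
  apply: in_spanD; first by apply: filt_mono (h r); exact: leq_pred.
  apply: in_span_sum => p pv _; apply/in_spanZ/filt_dword.
  by rewrite (size_dels pv).
elim: v {r} => [|m v IH] r.
  rewrite big_nil subr0; apply: filt_J; rewrite /shiftE /dword lmul_word.
  by apply: J_ind; right; right; exists r.
pose g := shiftE r (dword v) - \sum_(p <- dels v) (half r * phih (r + p.1)) *: dword p.2.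
have fE : shiftE r (dword (m :: v)) - \sum_(p <- dels (m :: v))
      (half r * phih (r + p.1)) *: dword p.2 =
   (shiftE r (dword (m :: v)) - lmulT (gD m) (shiftE r (dword v))
      - half r *: lmulT (gH (m + r)) (dword v))
   + (lmulT (gD m) g + half r *: shiftE (m + r) (dword v)).
  rewrite /= big_cons big_map /g (lmulB _ (shiftE r (dword v))) lmul_sum.
  under [in RHS]eq_bigr => p _ do rewrite lmulZ lmul_word -/(dword (m :: p.2)).
  rewrite /shiftE scalerBr scalerA [r + m]addrC /=.
  set a := lmulT _ _; set b := _ *: lmulT _ (dword v).
  set c := _ *: dword v; set d := \sum_(p <- _) _; set e := _ *: dword (m :: v).
  set k := lmulT (gD m) _.
  by apply/funext => w; rewrite !vecE; ring.
rewrite fE; apply: in_spanD; first exact/filt_J/shiftE_lmulD.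
(* For empty v the predecessor is truncated at 0 and [filt_lmulD] would only give [filt 1];
   membership in J is used instead. *)
case: v @g IH {fE} => [|n v] g IH; apply: in_spanD.
- by apply/filt_J/J_lmul/filt0/IH.
- rewrite /shiftE /dword lmul_word; apply/in_spanZ/filt_J/J_ind.
  by right; right; exists (m + r).
- exact/filt_lmulD/IH.
- apply: in_spanZ.
  rewrite -(subrK (\sum_(p <- dels (n :: v)) (half (m + r) * phih (m + r + p.1)) *: dword p.2)
     (shiftE (m + r) (dword (n :: v)))).
  apply: in_spanD; first by apply: filt_mono (IH (m + r)); exact: leq_pred.
  apply: in_span_sum => p pv _; apply/in_spanZ/filt_dword.
  by have /= := size_dels pv; lia.
Qed.

Lemma filt_shiftE k r (f : T) : filt k.+1 f -> filt k (shiftE r f).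
Proof.
move: f; apply: (@in_span_elim _ (fun f => filt k (shiftE r f))).
- by rewrite shiftE0; apply: in_span0.
- by move=> f g ? ?; rewrite shiftED; apply: in_spanD.
- by move=> c f ?; rewrite shiftEZ; apply: in_spanZ.
move=> f [Jf|[v lt ->]]; first exact/filt_J/shiftE_J.
by apply: filt_mono (shiftE_dword r v).2.
Qed.

(** g commutes with every d_m, so it can be moved through a monomial to the cyclic vector, where it
    is the scalar [phi g]. *)
Lemma filt_central k g (f : T) : g = gC \/ g = gL -> filt k f ->
  J (lmulT g f - phi g *: f).
Proof.
move=> gc; move: f; apply: (@in_span_elim _ (fun f => J (lmulT g f - phi g *: f))).
- by rewrite lmul0 scaler0 subrr; apply: in_span0.
- by move=> f1 f2 h1 h2; rewrite lmulD scalerDr opprD addrACA; apply: in_spanD.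
- move=> c f h; rewrite lmulZ scalerA mulrC -scalerA -scalerBr; exact: in_spanZ.
move=> f [Jf|[v _ ->]]; first by apply: in_spanB; [apply: J_lmul|apply: in_spanZ].
elim: v => [|m v IH].
  by rewrite lmul_word; apply: J_ind; case: gc => ->; [left|right; left].
have := J_bracket g (gD m) (map gD v).
have -> : bracket g (gD m) = [::] by case: gc => ->.
rewrite big_nil subr0 => h.
have -> : lmulT g (dword (m :: v)) - phi g *: dword (m :: v) =
    (word (g :: gD m :: map gD v) - word (gD m :: g :: map gD v)) +
    lmulT (gD m) (lmulT g (dword v) - phi g *: dword v).
  by rewrite lmulB lmulZ !lmul_word addrA subrK.
by apply: in_spanD => //; apply: J_lmul.
Qed.

(** The spanning half of Poincare-Birkhoff-Witt: a letter h, c or l in front acts as a scalar up to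
    lower terms, so every word reduces modulo J to unordered monomials in the d's. *)
Lemma filt_word w : exists k, filt k (word w).
Proof.
elim: w => [|g w [k IH]]; first by exists 1%N; apply: (@filt_dword _ [::]).
rewrite -lmul_word; case: g => [m|r||].
- by exists k.+1; apply: filt_lmulD.
- exists k; rewrite -(subrK (phih r *: word w) (lmulT _ _)).
  apply: in_spanD; last exact: in_spanZ.
  by apply: (@filt_shiftE _ r (word w)); apply: filt_mono IH.
- exists k; rewrite -(subrK (phi gC *: word w) (lmulT _ _)).
  by apply: in_spanD; [apply/filt_J/(filt_central _ IH); left|apply: in_spanZ].
- exists k; rewrite -(subrK (phi gL *: word w) (lmulT _ _)).
  by apply: in_spanD; [apply/filt_J/(filt_central _ IH); right|apply: in_spanZ].
Qed.

Lemma filt_fin_supp (f : T) : fin_supp f -> exists k, filt k f.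
Proof.
case/fin_supp_sum => s ->; move: (f : seq gen -> C) => a.
elim: s => [|w s [k IH]]; first by exists 0%N; rewrite big_nil; apply: in_span0.
have [l hl] := filt_word w; exists (maxn k l); rewrite big_cons; apply: in_spanD.
  by apply: in_spanZ; apply: filt_mono hl; apply: leq_maxr.
by apply: filt_mono IH; apply: leq_maxl.
Qed.

(** For lists of equal length, the permanent of the matrix with entries [half r * phih (r + m)], r
    in R and m in v, expanded along its first row. *)
Fixpoint pairing (R v : seq int) : C :=
  if R is r :: R' then
    \sum_(p <- dels v) half r * phih (r + p.1) * pairing R' p.2
  else 1.

Definition shiftEs R f := foldl (fun f r => shiftE r f) f R.

Lemma shiftEsD R f g : shiftEs R (f + g) = shiftEs R f + shiftEs R g.
Proof. by elim: R f g => //= r R IH f g; rewrite shiftED IH. Qed.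

Lemma shiftEsZ R c f : shiftEs R (c *: f) = c *: shiftEs R f.
Proof. by elim: R f => //= r R IH f; rewrite shiftEZ IH. Qed.

Lemma shiftEs0 R : shiftEs R 0 = 0.
Proof. by elim: R => //= r R IH; rewrite shiftE0. Qed.

Lemma shiftEs_sum R I (r : seq I) (F : I -> T) :
  shiftEs R (\sum_(i <- r) F i) = \sum_(i <- r) shiftEs R (F i).
Proof. exact: (big_morph (shiftEs R) (shiftEsD R) (shiftEs0 R)). Qed.

Lemma shiftEs_filt R f : filt (size R) f -> J (shiftEs R f).
Proof. by elim: R f => [|r R IH] f /=; [exact: filt0|move/(filt_shiftE r)/IH]. Qed.

(** Each operator acts through its leading derivation; the error terms are too short to survive the
    remaining operators. *)
Lemma shiftEs_dword R v : size v = size R ->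
  J (shiftEs R (dword v) - pairing R v *: word [::]).
Proof.
elim: R v => [|r R IH] v.
  by move/size0nil=> ->; rewrite scale1r subrr; apply: in_span0.
move=> sv /=; have [h _] := shiftE_dword r v.
pose S := \sum_(p <- dels v) (half r * phih (r + p.1)) *: dword p.2.
rewrite -(subrK S (shiftE r _)) shiftEsD -addrA; apply: in_spanD.
  by apply: shiftEs_filt; rewrite sv in h.
rewrite shiftEs_sum scaler_suml -sumrB; apply: in_span_sum => p pv _.
rewrite shiftEsZ -scalerA -scalerBr; apply/in_spanZ/IH.
by move: (size_dels pv); rewrite sv => -[].
Qed.

(* Euler's identity for the symbol of [dword v] in the associated graded algebra. *)
Lemma euler_dels v : filt (size v)
  (\sum_(p <- dels v) dword (p.1 :: p.2) - (size v)%:R *: dword v).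
Proof.
elim: v => [|m v IH]; first by rewrite big_nil scale0r subrr; apply: in_span0.
rewrite /= big_cons big_map /=.
have -> : dword (m :: v) + \sum_(p <- dels v) dword [:: p.1, m & p.2]
     - (size v).+1%:R *: dword (m :: v) =
   lmulT (gD m) (\sum_(p <- dels v) dword (p.1 :: p.2) - (size v)%:R *: dword v)
   + \sum_(p <- dels v) (dword [:: p.1, m & p.2] - dword [:: m, p.1 & p.2]).
  rewrite lmulB lmul_sum lmulZ lmul_word -/(dword (m :: v)) sumrB.
  under [X in X - _ + _]eq_bigr do rewrite lmul_word.
  rewrite -natr1 scalerDl scale1r; set a := dword (m :: v).
  by apply/funext => w; rewrite !vecE; ring.
apply: in_spanD; first exact: filt_lmulD.
apply: in_span_sum => -[n u] /size_dels /= su _.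
have := J_bracket (gD n) (gD m) (map gD u); set S := \sum_(p <- _) _ => h.
rewrite -(subrK S (_ - _)); apply: in_spanD; first exact: filt_J.
rewrite /S /= !big_cons big_nil addr0; apply: in_spanD; apply: in_spanZ.
  by apply: (@filt_dword _ (n + m :: u)); rewrite su.
rewrite -lmul_word -(subrK (phi gC *: dword u) (lmulT _ _)).
have fu : filt (size v).+1 (dword u) by apply: filt_dword; rewrite su; lia.
by apply: in_spanD; [apply/filt_J/(filt_central _ fu); left|apply: in_spanZ].
Qed.

(** * Separation of leading terms *)

Hypothesis not_exp : ~ exp_polynomial phih.

(** Induction on k. Varying the first entry of R gives a relation between shifts of [phih], so for
    each m the cofactors of d_m pair to zero and lie in [filt k]. Multiplying them by d_m and
    summing over m gives k+1 times the original sum modulo [filt k.+1], by Euler's identity. *)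
Lemma pairing_separates k (L : seq (C * seq int)) : all (fun p => size p.2 == k) L ->
  (forall R, size R = k -> \sum_(p <- L) p.1 * pairing R p.2 = 0) ->
  filt k (\sum_(p <- L) p.1 *: dword p.2).
Proof.
elim: k L => [|k IH] L sL L0.
  have := L0 [::] erefl; under eq_bigr do rewrite mulr1.
  move=> s0; rewrite (_ : \sum_(p <- L) _ = (\sum_(p <- L) p.1) *: word [::]).
    by rewrite s0 scale0r; apply: in_span0.
  rewrite scaler_suml; apply: eq_big_seq => p /(allP sL)/eqP/size0nil e.
  by rewrite e.
(* The formal partial derivatives of L: [x.2.1] is the removed letter, [x.2.2] the cofactor. *)
pose M := [seq (p.1, q) | p <- L, q <- dels p.2].
have sM x : x \in M -> size x.2.2 = k.
  case/allpairsPdep=> p [q [pL /size_dels sq ->]] /=.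
  by move: (allP sL _ pL); rewrite sq eqSS => /eqP.
have M0 m R : size R = k -> \sum_(x <- M | x.2.1 == m) x.1 * pairing R x.2.2 = 0.
  move=> sR; pose N := [seq (x.1 * pairing R x.2.2, x.2.1) | x <- M].
  have := @shift_independent phih N not_exp _ m; rewrite big_map /=; apply=> n.
  have := L0 (n :: R) _; rewrite /= sR => /(_ erefl) e.
  apply: (mulfI (half_neq0 n)); rewrite mulr0 -[RHS]e !big_map /M.
  rewrite big_allpairs_dep /= big_distrr /=; apply: eq_bigr => p _.
  rewrite !big_distrr /=; apply: eq_bigr => q _.
  by rewrite [n + _]addrC; ring.
have fM m : filt k (\sum_(x <- M | x.2.1 == m) x.1 *: dword x.2.2).
  have := IH [seq (x.1, x.2.2) | x <- M & x.2.1 == m].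
  rewrite big_map big_filter; apply.
    apply/allP => q /mapP[x xM ->]; move: xM; rewrite mem_filter => /andP[_ /sM s] /=.
    by rewrite s.
  by move=> R sR; rewrite big_map big_filter /= M0.
have gM : filt k.+1 (\sum_(x <- M) x.1 *: dword (x.2.1 :: x.2.2)).
  have -> : \sum_(x <- M) x.1 *: dword (x.2.1 :: x.2.2) =
      \sum_(m <- undup [seq x.2.1 | x <- M])
        lmulT (gD m) (\sum_(x <- M | x.2.1 == m) x.1 *: dword x.2.2).
    under [RHS]eq_bigr do rewrite lmul_sum.
    rewrite (exchange_big_dep predT) //=; apply: eq_big_seq => x xM.
    rewrite (big_rem x.2.1) /=; last by rewrite mem_undup; apply: (map_f (fun x => x.2.1)).
    rewrite eqxx big_seq_cond big1 ?addr0 => [|a /andP[]].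
      by rewrite lmulZ lmul_word.
    rewrite mem_rem_uniq ?undup_uniq // inE => /andP[/negP h _] /eqP e.
    by case: h; rewrite e.
  by apply: in_span_sum => m _ _; apply: filt_lmulD.
have k0 : k.+1%:R != 0 :> C by rewrite natC_eq0.
rewrite -[X in filt _ X](scalerK k0); apply: in_spanZ.
move: gM; rewrite big_allpairs_dep /=; set G := (X in filt _ X) => gM.
rewrite -[X in in_span _ X](subKr G); apply: in_spanB => //.
rewrite scaler_sumr -sumrB; apply: in_span_sum => p pL _.
rewrite -scaler_sumr scalerA mulrC -scalerA -scalerBr; apply: in_spanZ.
by rewrite -(eqP (allP sL _ pL)); apply: euler_dels.
Qed.

Lemma filt_symbol k (f : T) : filt k.+1 f -> exists2 L : seq (C * seq int),
  all (fun p => size p.2 == k) L & filt k (f - \sum_(p <- L) p.1 *: dword p.2).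
Proof.
move: f; apply: (@in_span_elim _ (fun f => exists2 L : seq (C * seq int),
  all (fun p => size p.2 == k) L & filt k (f - \sum_(p <- L) p.1 *: dword p.2))).
- by exists [::] => //; rewrite big_nil subr0; apply: in_span0.
- move=> f g [L sL hL] [M sM hM]; exists (L ++ M); first by rewrite all_cat sL.
  by rewrite big_cat opprD addrACA; apply: in_spanD.
- move=> c f [L sL hL]; exists [seq (c * p.1, p.2) | p <- L].
    by rewrite all_map; apply: sub_all sL.
  rewrite big_map /=; under eq_bigr do rewrite -scalerA.
  by rewrite -scaler_sumr -scalerBr; apply: in_spanZ.
move=> f [Jf|[v lt ->]].
  by exists [::] => //; rewrite big_nil subr0; apply: filt_J.
have [sv|nv] := eqVneq (size v) k.
  exists [:: (1, v)]; first by rewrite /= sv eqxx.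
  by rewrite big_seq1 scale1r subrr; apply: in_span0.
exists [::] => //; rewrite big_nil subr0; apply: filt_dword; lia.
Qed.

Section Submodule.
Variable S : tens -> Prop.
Hypothesis subS : is_submodule_pre J S.

Lemma submodD (f g : T) : S f -> S g -> S (f + g).
Proof. by case: subS => _ _ h _ _; apply: h. Qed.

Lemma submodZ a (f : T) : S f -> S (a *: f).
Proof. by case: subS => _ _ _ h _; apply: h. Qed.

Lemma submodJ (f : T) : J f -> S f.
Proof. by case: subS => _ h _ _ _; apply: h. Qed.

Lemma submod_lmul g (f : T) : S f -> S (lmulT g f).
Proof. by case: subS => _ _ _ _; apply. Qed.

Lemma submodB (f g : T) : S f -> S g -> S (f - g).
Proof. by move=> ? ?; rewrite -scaleN1r; apply/submodD/submodZ. Qed.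

Lemma submod_shiftEs R f : S f -> S (shiftEs R f).
Proof.
elim: R f => //= r R IH f Sf; apply/IH/submodB; first exact: submod_lmul.
exact: submodZ.
Qed.

Lemma submod_word : S (word [::]) -> forall f : T, fin_supp f -> S f.
Proof.
move=> S1 f /fin_supp_sum[s ->]; elim/big_ind: _ => [||w _].
- by rewrite -(scale0r (word [::])); apply: submodZ.
- exact: submodD.
- by apply: submodZ; elim: w => // g w IH; rewrite -lmul_word; apply: submod_lmul.
Qed.

(** If some R pairs nontrivially with the leading part of f, then [shiftEs R f] is a nonzero
    multiple of the cyclic vector modulo J; otherwise [pairing_separates] puts f one step lower. At
    the bottom f would be in J. *)
Lemma submod_cyclic k (f : T) : filt k f -> S f -> ~ J f -> S (word [::]).
Proof.
elim: k f => [|k IH] f fk Sf nJ; first by case: nJ; apply: filt0.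
have [L sL fL] := filt_symbol fk.
have [[R sR Rn0]|h] := pselect (exists2 R, size R = k &
    \sum_(p <- L) p.1 * pairing R p.2 != 0).
  set c := (X in X != 0) in Rn0.
  suff Sc : S (c *: word [::]).
    by rewrite -(scalerK Rn0 (word [::])); apply: submodZ.
  rewrite -[_ *: _](subKr (shiftEs R f)); apply: submodB; first exact: submod_shiftEs.
  apply: submodJ; pose g := \sum_(p <- L) p.1 *: dword p.2.
  rewrite -(subrK g f) shiftEsD -addrA; apply: in_spanD.
    by apply: shiftEs_filt; rewrite sR.
  rewrite shiftEs_sum /c scaler_suml -sumrB; apply: in_span_sum => p pL _.
  rewrite shiftEsZ -scalerA -scalerBr; apply/in_spanZ/shiftEs_dword.
  by rewrite sR; apply/eqP/(allP sL).
apply: IH Sf nJ; rewrite -(subrK (\sum_(p <- L) p.1 *: dword p.2) f).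
apply: in_spanD => //; apply: pairing_separates => // R sR.
by apply/eqP/negPn/negP => n0; apply: h; exists R.
Qed.

Lemma submod_trivial : (forall f, S f <-> J f) \/ (forall f, S f <-> fin_supp f).
Proof.
have [[f [Sf nJ]]|h] := pselect (exists f, S f /\ ~ J f).
  right=> g; split=> [Sg|]; first by case: subS => h *; apply: h.
  case: (subS) => /(_ f Sf)/filt_fin_supp[k fk] _ _ _ _.
  exact/submod_word/(submod_cyclic fk).
left=> f; split=> [Sf|]; last exact: submodJ.
by have [//|nJ] := pselect (J f); case: h; exists f.
Qed.
End Submodule.
End Whittaker.

(** * An explicit module with a vector of character phi *)

(* A function on words is a linear functional on the free algebra over [gen], where
   [gD n], [gH n], [gC] play the roles of u_n, x_n, z; [mull y] and [derT m] are the
   transposes of left multiplication by [y] and of the derivation extending [der m].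
   The inhomogeneous term (m^2 + m) z / 24 and the multiplier m + 1 in [act] are what
   produces the cocycle (m^3 - m) z / 12. *)
Definition der (m : int) (y : gen) : seq (C * gen) :=
  match y with
  | gD n => [:: (n%:~R, gD (m + n));
      (if m + n == 0 then (m ^+ 2 + m)%:~R / 24%:R else 0, gC)]
  | gH n => [:: (half n, gH (m + n))]
  | _ => [::]
  end.

Definition mull (y : gen) (xi : T) : T := fun w => xi (y :: w).

Fixpoint derw m (w : seq gen) (xi : T) : C :=
  if w is y :: w' then
    \sum_(p <- der m y) p.1 * xi (p.2 :: w') + derw m w' (mull y xi)
  else 0.

Definition derT m (xi : T) : T := fun w => derw m w xi.

Lemma derT_cons m xi y w : derT m xi (y :: w) =
  \sum_(p <- der m y) p.1 * xi (p.2 :: w) + derT m (mull y xi) w.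
Proof. by []. Qed.

Lemma mull_derT m xi y : mull y (derT m xi) =
  \sum_(p <- der m y) p.1 *: mull p.2 xi + derT m (mull y xi).
Proof. by apply/funext => w; rewrite vecD vec_sum /mull derT_cons. Qed.

Lemma derTD m f g : derT m (f + g) = derT m f + derT m g.
Proof.
apply/funext => w; rewrite vecD; elim: w f g => [|y w IH] f g; first by rewrite /derT /= addr0.
rewrite !derT_cons (IH (mull y f) (mull y g)).
under eq_bigr do rewrite vecD mulrDr.
by rewrite big_split addrACA.
Qed.

Lemma derTZ m c f : derT m (c *: f) = c *: derT m f.
Proof.
apply/funext => w; rewrite vecZ; elim: w f => [|y w IH] f; first by rewrite /derT /= mulr0.
rewrite !derT_cons (IH (mull y f)) mulrDr big_distrr /=.
by under eq_bigr do rewrite vecZ mulrCA.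
Qed.

Lemma derT0 m : derT m 0 = 0.
Proof. by have := derTZ m 0 0; rewrite !scale0r. Qed.

Lemma derT_sum m I (r : seq I) (F : I -> T) :
  derT m (\sum_(i <- r) F i) = \sum_(i <- r) derT m (F i).
Proof. exact: (big_morph (derT m) (derTD m) (derT0 m)). Qed.

(** A commutator of derivations is a derivation, so letters suffice ([key]). Transposition reverses
    composition, which turns the factor n - m into m - n. *)
Lemma derT_bracket m n xi :
  derT m (derT n xi) - derT n (derT m xi) = (m - n)%:~R *: derT (m + n) xi.
Proof.
apply/funext => w; rewrite vecD vecN vecZ.
elim: w xi => [|y w IH] xi; first by rewrite /derT /= subrr mulr0.
rewrite !derT_cons !mull_derT !derTD !derT_sum !vecD !vec_sum.
have /eqP := IH (mull y xi); rewrite subr_eq => /eqP ->.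
under [X in _ + (X + _) - _ = _]eq_bigr do rewrite derTZ vecZ.
under [X in _ - (_ + (X + _)) = _]eq_bigr do rewrite derTZ vecZ.
under [X in X + _ - _ = _]eq_bigr do rewrite derT_cons mulrDr.
under [X in _ - (X + _) = _]eq_bigr do rewrite derT_cons mulrDr.
rewrite !big_split /=.
have key : \sum_(p <- der m y) p.1 * (\sum_(q <- der n p.2) q.1 * xi (q.2 :: w))
   = \sum_(p <- der n y) p.1 * (\sum_(q <- der m p.2) q.1 * xi (q.2 :: w))
   + (m - n)%:~R * \sum_(p <- der (m + n) y) p.1 * xi (p.2 :: w).
  case: y => [k|k||]; rewrite /= ?big_cons ?big_nil /= ?big_cons ?big_nil; last 2 first.
  - by rewrite mulr0 addr0.
  - by rewrite mulr0 addr0.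
  - rewrite [n + (m + k)]addrCA !addrA; case: eqP => [e|_].
      have -> : k = - (m + n) by lia.
      by rewrite !(rmorphD, rmorphN, rmorphXn) /=; move: (24%:R^-1 : C) => c; ring.
    by rewrite !(rmorphD, rmorphN) /=; ring.
  - rewrite [n + (m + k)]addrCA !addrA /half.
    by rewrite !(rmorphD, rmorphN) /=; ring.
rewrite key mulrDr.
set a := (_ - _)%:~R * _; ring.
Qed.

Definition act (g : gen) (xi : T) : T :=
  match g with
  | gD m => derT m xi + (m + 1)%:~R *: mull (gD m) xi
  | gL => 0
  | y => mull y xi
  end.

(** These functionals factor through the polynomial ring; on them the operators [mull y] commute. *)
Definition symmetric (xi : T) : Prop :=
  forall u y z w, xi (u ++ y :: z :: w) = xi (u ++ z :: y :: w).

Lemma symmetric_mull xi y : symmetric xi -> symmetric (mull y xi).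
Proof. by move=> sxi u a b w; apply: (sxi (y :: u)). Qed.

Lemma symmetric_derT m xi : symmetric xi -> symmetric (derT m xi).
Proof.
move=> sxi u y z w; elim: u xi sxi => [|a u IH] xi sxi; last first.
  rewrite !cat_cons !derT_cons (IH _ (symmetric_mull a sxi)).
  by congr (_ + _); apply: eq_bigr => p _; rewrite (sxi (p.2 :: u)).
rewrite !cat0s !derT_cons.
have -> : mull z (mull y xi) = mull y (mull z xi).
  by apply/funext => v; apply: (sxi [::]).
rewrite !addrA; congr (_ + _); rewrite addrC; congr (_ + _).
  by apply: eq_bigr => p _; rewrite /mull (sxi [::]).
by apply: eq_bigr => p _; rewrite /mull (sxi [::]).
Qed.

Lemma symmetric_act g xi : symmetric xi -> symmetric (act g xi).
Proof.
move=> sxi; case: g => [m|n||] //=; try exact: symmetric_mull.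
move=> u y z w; rewrite !vecD !vecZ (symmetric_derT m sxi).
by rewrite (symmetric_mull (gD m) sxi).
Qed.

Lemma actD g f f' : act g (f + f') = act g f + act g f'.
Proof.
case: g => [m|n||] //=; last by rewrite addr0.
by rewrite derTD addrACA -scalerDr.
Qed.

Lemma actZ g c f : act g (c *: f) = c *: act g f.
Proof.
case: g => [m|n||] //=; last by rewrite scaler0.
by rewrite derTZ scalerDr scalerA mulrC -scalerA.
Qed.

Lemma act0 g : act g 0 = 0.
Proof. by have := actZ g 0 0; rewrite !scale0r. Qed.

Lemma act_sum g I (r : seq I) (F : I -> T) :
  act g (\sum_(i <- r) F i) = \sum_(i <- r) act g (F i).
Proof. exact: (big_morph (act g) (actD g) (act0 g)). Qed.

(** For two d's, the cross brackets of derivations and multipliers add up to (m - n)(m + n + 1)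
    u_(m+n) and, when m + n = 0, to (m^3 - m) z / 12. Symmetry cancels the products of
    multipliers. *)
Lemma act_bracket x y xi : symmetric xi ->
  act x (act y xi) - act y (act x xi) = \sum_(p <- bracket x y) p.1 *: act p.2 xi.
Proof.
move=> sxi; have sw a b w : xi (a :: b :: w) = xi (b :: a :: w) by apply: (sxi [::]).
have mullE y0 f w : mull y0 f w = f (y0 :: w) by [].
apply/funext => w; rewrite vec_sum.
case: x => [m|k||]; case: y => [n|l||] /=;
  rewrite ?big_cons ?big_nil ?derT0 /= ?derTD ?derTZ;
  rewrite !(vecE, mullE) ?derT_cons ?derT_cons /= ?big_cons ?big_nil /=.
all: try by [ring|rewrite sw; ring].
have := congr1 (fun f : T => f w) (derT_bracket m n xi).
rewrite !vecE => /eqP; rewrite subr_eq => /eqP ->.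
rewrite (sw (gD n)) [n + m]addrC; case: eqP => [e|_]; last first.
  by rewrite !(rmorphD, rmorphN) /=; ring.
have e12 : 12%:R^-1 = 2%:R * 24%:R^-1 :> C.
  have n2 : 2%:R != 0 :> C by rewrite natC_eq0.
  by rewrite (_ : 24%N = (2 * 12)%N) // natrM invfM mulrA divff // mul1r.
have -> : n = - m by lia.
rewrite e12 !(rmorphD, rmorphN, rmorphXn) /=; move: (24%:R^-1 : C) => c; ring.
Qed.

(** * Linear extension from words to finitely supported tensors *)

Definition covers (s : seq (seq gen)) (f : tens) :=
  uniq s /\ forall w, f w != 0 -> w \in s.

Definition supp (f : tens) : seq (seq gen) :=
  if pselect (exists s, covers s f) is left h then sval (cid h) else [::].

Lemma supp_covers f : fin_supp f -> covers (supp f) f.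
Proof.
move=> [s fs]; rewrite /supp; case: pselect => [h|[]]; first by case: cid.
by exists (undup s); split=> [|w /fs]; rewrite ?undup_uniq ?mem_undup.
Qed.

(** The support list is chosen classically; by [extendE], any duplicate-free list containing the
    support gives the same value. *)
Definition extend (G : seq gen -> T) (f : T) : T := \sum_(w <- supp f) f w *: G w.

Section Extend.
Variable G : seq gen -> T.

Lemma extendE s (f : T) : covers s f -> extend G f = \sum_(w <- s) f w *: G w.
Proof.
move=> cs; have fsf : fin_supp f by exists s; case: cs.
have [uf cf] := supp_covers fsf; have [us cov] := cs.
have drop0 (r : seq (seq gen)) :
    \sum_(w <- r) f w *: G w = \sum_(w <- r | f w != 0) f w *: G w.
  rewrite (bigID (fun w => f w != 0)) /= [X in _ + X]big1 ?addr0 // => w.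
  by rewrite negbK => /eqP->; rewrite scale0r.
rewrite /extend drop0 [RHS]drop0 -[LHS]big_filter -[RHS]big_filter; apply: perm_big.
apply: uniq_perm; rewrite ?filter_uniq // => w; rewrite !mem_filter.
by case: (boolP (f w != 0)) => // h; rewrite cf ?cov.
Qed.

Lemma covers_sub s t (f : T) : covers s f -> uniq t -> {subset s <= t} -> covers t f.
Proof. by move=> [_ cs] ut st; split=> // w /cs/st. Qed.

Lemma extendD (f g : T) : fin_supp f -> fin_supp g -> extend G (f + g) = extend G f + extend G g.
Proof.
move=> ff fg; pose s := undup (supp f ++ supp g).
have cf : covers s f.
  apply: covers_sub (supp_covers ff) (undup_uniq _) _ => w wf.
  by rewrite mem_undup mem_cat wf.
have cg : covers s g.
  apply: covers_sub (supp_covers fg) (undup_uniq _) _ => w wg.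
  by rewrite mem_undup mem_cat wg orbT.
have cfg : covers s (f + g).
  case: cf cg => us cf [_ cg]; split=> // w; rewrite vecD.
  by have [->|/cf//] := eqVneq (f w) 0; rewrite add0r => /cg.
rewrite (extendE cf) (extendE cg) (extendE cfg) -big_split /=.
by apply: eq_bigr => w _; rewrite vecD scalerDl.
Qed.

Lemma extendZ a (f : T) : fin_supp f -> extend G (a *: f) = a *: extend G f.
Proof.
move=> ff; have cf := supp_covers ff.
have caf : covers (supp f) (a *: f).
  case: cf => us cf; split=> // w.
  by rewrite vecZ mulf_eq0 negb_or => /andP[_ /cf].
rewrite (extendE cf) (extendE caf) scaler_sumr.
by apply: eq_bigr => w _; rewrite vecZ scalerA.
Qed.

Lemma extend_word w : extend G (word w) = G w.
Proof.
rewrite (@extendE [:: w]); first by rewrite big_seq1 /word /ew eqxx scale1r.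
by split=> // u; rewrite inE /word /ew; case: (u == w); rewrite //= eqxx.
Qed.

Lemma extendB (f g : T) : fin_supp f -> fin_supp g -> extend G (f - g) = extend G f - extend G g.
Proof.
move=> ff fg; have fN := fin_suppZ (-1) fg.
by rewrite -[- g]scaleN1r extendD // extendZ // scaleN1r.
Qed.

Lemma extend0 : extend G 0 = 0.
Proof.
rewrite (@extendE [::]) ?big_nil //.
by split=> // w; rewrite vec0 eqxx.
Qed.

Lemma extend_sum I (r : seq I) (F : I -> T) : (forall i, fin_supp (F i)) ->
  extend G (\sum_(i <- r) F i) = \sum_(i <- r) extend G (F i).
Proof.
move=> fF; elim: r => [|i r IH]; first by rewrite !big_nil extend0.
by rewrite !big_cons extendD ?IH //; apply: fin_supp_bigsum.
Qed.

End Extend.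

Definition act_word xi (w : seq gen) : T := foldr act xi w.

Lemma extend_lmul xi g (f : T) : fin_supp f ->
  extend (act_word xi) (lmulT g f) = act g (extend (act_word xi) f).
Proof.
move=> ff; have [us cov] := supp_covers ff.
rewrite (@extendE _ [seq g :: w | w <- supp f]); last first.
  split=> [|[|x w]]; first by rewrite map_inj_uniq // => u v [].
    by rewrite /lmulT /= eqxx.
  rewrite /lmulT /=; have [->|_] := eqVneq x g; last by rewrite eqxx.
  by move/cov/(map_f (cons g)).
rewrite big_map act_sum; apply: eq_bigr => w _.
by rewrite actZ /lmulT /= eqxx.
Qed.

(** * Evaluation at a point and its annihilator *)

Section Evaluation.
Variables (phic : C) (phih : int -> C) (u : int -> C).

Definition point (y : gen) : C :=
  match y with gD n => u n | gH n => phih n | gC => phic | gL => 0 end.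

Definition ev : T := fun w => \prod_(y <- w) point y.

Lemma symmetric_ev : symmetric ev.
Proof. by move=> v y z w; rewrite /ev !big_cat !big_cons /= [point y * _]mulrCA. Qed.

Lemma mull_ev y : mull y ev = point y *: ev.
Proof. by apply/funext => w; rewrite /mull /ev big_cons. Qed.

Lemma ev_nil : ev [::] = 1.
Proof. exact: big_nil. Qed.

Lemma symmetric_act_word w : symmetric (act_word ev w).
Proof. by elim: w => [|g w IH]; [exact: symmetric_ev|exact: symmetric_act]. Qed.

(** The annihilator of [ev] in the tensor algebra; as it contains J, it describes the kernel of the
    map from W(phi) sending the cyclic vector to [ev]. *)
Definition killed (f : tens) : Prop := fin_supp f /\ extend (act_word ev) f = 0.

Lemma killed_lmul g (f : T) : killed f -> killed (lmulT g f).
Proof.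
move=> [ff f0]; split; first exact: fin_supp_lmul.
by rewrite extend_lmul // f0 act0.
Qed.

Lemma killedD (f g : T) : killed f -> killed g -> killed (f + g).
Proof.
move=> [ff f0] [fg g0]; split; first exact: fin_suppD.
by rewrite extendD // f0 g0 addr0.
Qed.

Lemma killedZ a (f : T) : killed f -> killed (a *: f).
Proof.
move=> [ff f0]; split; first exact: fin_suppZ.
by rewrite extendZ // f0 scaler0.
Qed.

Lemma killed_lie_rel v x y w : killed (lie_rel v x y w).
Proof.
elim: v => [|g v IH]; last by rewrite -lmul_lie_rel; apply: killed_lmul.
have fs1 p : fin_supp (p.1 *: word (p.2 :: w)) := fin_suppZ p.1 (fin_supp_word _).
have fs2 := fin_supp_word (x :: y :: w); have fs3 := fin_supp_word (y :: x :: w).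
have fs4 := fin_supp_bigsum (bracket x y) fs1.
rewrite lie_relE /=; split; first by do 2?apply: fin_suppB.
rewrite extendB ?extendB //; last exact: fin_suppB.
rewrite extend_sum // !extend_word /= act_bracket; last exact: symmetric_act_word.
apply/eqP; rewrite subr_eq0; apply/eqP/eq_bigr => p _.
by rewrite extendZ ?extend_word //; apply: fin_supp_word.
Qed.

(** [act] respects brackets on symmetric functionals, and [ev] is a vector of character phi. *)
Lemma killed_J f : Jrel phic 0 phih f -> killed f.
Proof.
move: f; apply: in_span_elim.
- by split; [exact: fin_supp0|exact: extend0].
- exact: killedD.
- exact: killedZ.
move=> f [[v [x [y [w ->]]]]|[v [x [px ->]]]]; first exact: killed_lie_rel.
elim: v => [|g v IH]; last by rewrite -lmul_ind_rel; apply: killed_lmul.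
rewrite -[ind_rel _ _ _ _ _]/(word [:: x] - phi_val phic 0 phih x *: word [::]).
have fs1 := fin_supp_word [:: x].
have fs2 := fin_suppZ (phi_val phic 0 phih x) (fin_supp_word [::]).
split; first exact: fin_suppB.
rewrite extendB // extendZ ?extend_word /=; last exact: fin_supp_word.
by case: px => [->|[->|[n ->]]] /=; rewrite ?mull_ev ?scale0r subrr.
Qed.

Lemma killed_submodule : is_submodule_pre (Jrel phic 0 phih) killed.
Proof.
split.
- by move=> f [].
- exact: killed_J.
- exact: killedD.
- exact: killedZ.
- exact: killed_lmul.
Qed.

Lemma not_killed_one : ~ killed (word [::]).
Proof.
move=> [_]; rewrite extend_word => /(congr1 (fun f : T => f [::])).
by rewrite /= ev_nil vec0 => /eqP; rewrite oner_eq0.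
Qed.

Definition witness (q : {poly C}) (lam : C) : T :=
  \sum_(j < size q) q`_j *: word [:: gD j%:Z] - lam *: word [::].

Lemma extend_witness q lam : extend (act_word ev) (witness q lam) =
  \sum_(j < size q) q`_j *: derT j%:Z ev
  + (\sum_(j < size q) q`_j * ((j%:Z + 1)%:~R * u j%:Z) - lam) *: ev.
Proof.
have fs (j : 'I_(size q)) : fin_supp (q`_j *: word [:: gD j%:Z]).
  by apply/fin_suppZ/fin_supp_word.
rewrite /witness extendB; last 2 first.
- exact: fin_supp_bigsum.
- by apply/fin_suppZ/fin_supp_word.
rewrite extend_sum // extendZ ?extend_word; last exact: fin_supp_word.
rewrite scalerBl scaler_suml addrA -big_split; congr (_ - _).
apply: eq_bigr => j _; rewrite extendZ ?extend_word; last exact: fin_supp_word.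
by rewrite /= mull_ev scalerDr !scalerA mulrA.
Qed.

(** A vector field vanishing at a point on all coordinates vanishes there on all polynomials, by the
    Leibniz rule. *)
Lemma derT_ev_combination (q : {poly C}) :
  (forall y, \sum_(j < size q) q`_j * \sum_(p <- der j%:Z y) p.1 * point p.2 = 0) ->
  \sum_(j < size q) q`_j *: derT j%:Z ev = 0.
Proof.
move=> h; apply/funext => w; rewrite vec_sum vec0.
elim: w => [|y w IH].
  by rewrite big1 // => j _; rewrite vecZ /derT /= mulr0.
transitivity ((\sum_(j < size q) q`_j * \sum_(p <- der j%:Z y) p.1 * point p.2) * ev w
   + point y * \sum_(j < size q) (q`_j *: derT j%:Z ev) w).
  rewrite big_distrl big_distrr -big_split /=; apply: eq_bigr => j _.
  rewrite !vecZ derT_cons mull_ev derTZ vecZ mulrDr -mulrA; congr (_ * _ + _).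
    rewrite big_distrl; apply: eq_bigr => p _.
    by rewrite /ev big_cons mulrA.
  by rewrite mulrCA.
by rewrite h IH mul0r mulr0 addr0.
Qed.
End Evaluation.

(** The annihilator of [ev] contains x - lam but not 1, so irreducibility would make it equal to J.
    Then x - lam would also annihilate the evaluation at any other choice of u, which fails when u_0
    changes. *)
Lemma exp_polynomial_reducible phic phih : exp_polynomial phih ->
  ~ W_irreducible phic 0 phih.
Proof.
move=> /exp_polynomial_recurrent[s s0 rec] [_ irr].
set q := linear_factors s in rec.
have q0 : q`_0 != 0.
  rewrite -horner_coef0 /q /linear_factors; apply: contra s0.
  by rewrite -root_prod_XsubC.
(* This is q_(-n), with q extended by zero to all integer indices. *)
pose qopp (n : int) : C := \sum_(j < size q) (if j%:Z + n == 0 then q`_j else 0).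
(* The right-hand side makes the vector field sum_j q_j der_j vanish at [point]. *)
have [u uE] := shiftp_surj (fun n => - qopp n * ((n - 1)%:~R / 24%:R * phic)) s0.
pose lam := \sum_(j < size q) q`_j * ((j%:Z + 1)%:~R * u j%:Z).
have kx : killed phic phih u (witness q lam).
  split.
    apply: fin_suppB; last by apply/fin_suppZ/fin_supp_word.
    by apply: fin_supp_bigsum => j; apply/fin_suppZ/fin_supp_word.
  rewrite extend_witness -/lam subrr scale0r addr0.
  apply: derT_ev_combination => y; case: y => [n|n||] /=.
  - under eq_bigr do rewrite !big_cons big_nil /=.
    (* At j = -n the term j^2 + j equals n (n - 1), so a factor n splits off and the equation for u
       involves no division by n. *)
    transitivity (n%:~R * shiftp q u n + qopp n * ((n ^+ 2 - n)%:~R / 24%:R * phic)).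
      rewrite big_distrr big_distrl -big_split; apply: eq_bigr => j _ /=.
      rewrite [j%:Z + n]addrC; case: eqP => [e|_]; last by ring.
      have -> : j%:Z = - n by lia.
      by rewrite !(rmorphD, rmorphN, rmorphXn) /=; ring.
    rewrite uE; rewrite !(rmorphD, rmorphN, rmorphXn) /=; ring.
  - under eq_bigr do rewrite big_seq1 /=.
    transitivity (half n * shiftp q phih n); last by rewrite rec mulr0.
    rewrite big_distrr; apply: eq_bigr => j _ /=.
    by rewrite [j%:Z + n]addrC mulrCA.
  - by rewrite big1 // => j _; rewrite big_nil mulr0.
  - by rewrite big1 // => j _; rewrite big_nil mulr0.
case: (irr _ (killed_submodule phic phih u)) => [eJ|eT]; last first.
  by apply: (@not_killed_one phic phih u); apply/eT/fin_supp_word.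
(* Raising u_0 by 1 changes the value of x - lam at the empty word by exactly q_0. The new point
   need not be an eigenvector of x. *)
pose u' n := u n + (n == 0)%:R.
have [_] := @killed_J phic phih u' _ ((eJ _).1 kx).
rewrite extend_witness => /(congr1 (fun f : T => f [::])).
rewrite vecD vec_sum vecZ ev_nil mulr1 big1 ?add0r => [|j _]; last first.
  by rewrite vecZ /derT /= mulr0.
rewrite vec0 /lam -sumrB.
have : (0 < size q)%N by rewrite size_poly_gt0; apply: contra q0 => /eqP ->; rewrite coef0.
case: (size q) => // n _; rewrite big_ord_recl big1 ?addr0 => [|j _]; last first.
  by rewrite /u' /= addr0 subrr.
rewrite /u' /= => e; move/negP: q0; apply; apply/eqP; rewrite -[RHS]e.
by rewrite add0r; ring.
Qed.

(** J annihilates [ev], whose value at the empty word is 1; any choice of u would do, here u = 0. *)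
Lemma irreducible_nontrivial phic phih : ~ Jrel phic 0 phih (ew [::]).
Proof. by move/(@killed_J phic phih (fun=> 0))/not_killed_one. Qed.

Theorem theorem4p3 (phic phil : C) (phih : int -> C) :
  phi_is_lie_hom phic phil phih ->
  phi_H_nonzero phil phih ->
  (W_irreducible phic phil phih <-> ~ exp_polynomial phih).
Proof.
move=> hom _; have -> : phil = 0.
  (* The bracket of h_(1/2) and h_(-1/2) is l / 2, and phi vanishes on brackets. *)
  have := hom (gH 0) (gH (-1)) (or_intror (or_intror (ex_intro _ _ erefl)))
    (or_intror (or_intror (ex_intro _ _ erefl))).
  rewrite /= mul0r add0r => /eqP.
  by rewrite mulf_eq0 (negbTE (half_neq0 0)) => /eqP.
split=> [irr hexp|nexp]; first exact: exp_polynomial_reducible hexp irr.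
split; first exact: irreducible_nontrivial.
by move=> S subS; apply: submod_trivial nexp _ subS.
Qed.
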